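(* For every $\varepsilon>0$ and every $k\in\mathbb{N}$ there exist $n\in\mathbb{N}$ and a loopless matroid $\mathcal{M}\subseteq 2^{[n]}$ such that no algorithm is $(1/e+\varepsilon)$-competitive for the secretary problem with feasibility constraint $\mathcal{M}\lor\mathcal{U}^k$. Here $\mathcal{U}\subseteq 2^{[n]}$ is the $1$-uniform matroid, i.e. the family of subsets of $[n]$ of size at most $1$.
   Context: Matroids are identified with their families of independent sets. A matroid is loopless if every singleton is independent. For matroids $\mathcal{M}_1,\dots,\mathcal{M}_k$ on $N$, the union $\mathcal{M}_1\lor\dots\lor\mathcal{M}_k$ is the matroid consisting of all $S$ that can be partitioned into $S_1,\dots,S_k$ with $S_\ell\in\mathcal{M}_\ell$. The $k$-fold union is $\mathcal{U}^k=\bigvee_{i\in[k]}\mathcal{U}$. Secretary problem with feasibility constraint $\mathcal{F}\subseteq 2^N$, $N=[n]$: the elements have distinct nonnegative weights, unknown in advance, while $\mathcal{F}$ is known. The elements arrive one at a time in uniformly random order. On arrival an element's weight is revealed, and it must be irrevocably accepted or rejected, subject to the accepted set always lying in $\mathcal{F}$. $w(S)$ is the total weight of $S$. An algorithm is $\alpha$-competitive if for every weight assignment $\mathbb{E}[w(\mathrm{ALG})]\ge\alpha\cdot\max_{S\in\mathcal{F}}w(S)$. *)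

(* Defs.v *)
From mathcomp Require Import all_classical all_reals all_analysis.
From mathcomp Require Import all_boot all_order all_algebra all_fingroup.
Set Implicit Arguments. Unset Strict Implicit. Unset Printing Implicit Defensive.
Import Order.TTheory GRing.Theory Num.Theory.
Local Open Scope ring_scope.

Section Families.
Variable T : finType.

Definition is_matroid (M : {set {set T}}) : Prop :=
  [/\ set0 \in M,
      (forall A B : {set T}, B \in M -> A \subset B -> A \in M) &
      (forall A B : {set T}, A \in M -> B \in M -> (#|A| < #|B|)%N ->
         exists2 x, x \in B :\: A & x |: A \in M)].

Definition loopless (M : {set {set T}}) : Prop := forall x : T, [set x] \in M.

Definition union2 (M1 M2 : {set {set T}}) : {set {set T}} :=
  [set S : {set T} | [exists S1 : {set T}, [exists S2 : {set T},
     [&& S1 \in M1, S2 \in M2, S1 :|: S2 == S & [disjoint S1 & S2]]]]].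

Fixpoint union_list (Ms : seq {set {set T}}) : {set {set T}} :=
  match Ms with
  | [::] => [set set0]
  | M :: Ms' => union2 M (union_list Ms')
  end.

Definition uniform1 : {set {set T}} := [set S : {set T} | #|S| <= 1]%N.
Definition kfold (M : {set {set T}}) (k : nat) := union_list (nseq k M).

End Families.

(* Secretary problem.  A (randomized) online algorithm is given by a
   behavioural strategy: from the history of the past (element, weight,
   decision) triples, the currently arriving element and its weight, it
   returns the probability of accepting the current element. *)
Section Secretary.
Variable R : realType.
Variable n : nat.
Definition history := seq ('I_n * R * bool).
Definition algorithm := history -> 'I_n -> R -> R.

Definition valid_algorithm (A : algorithm) : Prop :=
  forall h e x, 0 <= A h e x <= 1.

Definition wsum (w : 'I_n -> R) (S : {set 'I_n}) : R := \sum_(i in S) w i.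

Fixpoint run (F : {set {set 'I_n}}) (A : algorithm) (w : 'I_n -> R)
    (h : history) (S : {set 'I_n}) (rest : seq 'I_n) : R :=
  match rest with
  | [::] => wsum w S
  | e :: rest' =>
      let p := if e |: S \in F then A h e (w e) else 0 in
      p * run F A w (rcons h (e, w e, true)) (e |: S) rest'
      + (1 - p) * run F A w (rcons h (e, w e, false)) S rest'
  end.

Definition expected_alg (F : {set {set 'I_n}}) (A : algorithm) (w : 'I_n -> R) : R :=
  (\sum_(s : {perm 'I_n}) run F A w [::] set0 [seq s i | i <- enum 'I_n])
    / #|{perm 'I_n}|%:R.

Definition opt (F : {set {set 'I_n}}) (w : 'I_n -> R) : R :=
  \big[Num.max/0]_(S in F) wsum w S.

Definition competitive (F : {set {set 'I_n}}) (A : algorithm) (alpha : R) : Prop :=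
  forall w : 'I_n -> R, injective w -> (forall i, 0 <= w i) ->
    alpha * opt F w <= expected_alg F A w.
End Secretary.

(* Main.v *)
(** Take the partition matroid with [m] blocks of size [t].  In the union with
    the [k]-fold 1-uniform matroid only [k] elements can be accepted beyond one
    per block; if the weights are bounded by [W] these are worth at most [k W],
    which is negligible for [m] large, so each block is a classical secretary
    problem in which only the first acceptance counts.

    Inside a block an element of value [z] weighs about [B ^ z], so only the
    maximum matters.  The values follow a scale-free prior (the discrete analogue
    of the Pareto mixture in the game of googol), for which the values seen so far
    carry no information on future records.  The optimal stopping value is then
    that of the ordinal problem, bounded by a discretisation of the continuous
    value function, [1/e] below [1/e] and [- x ln x] above.  The prior is improper
    and is truncated at [N], at a relative cost vanishing like [1 / ln N]; it is
    also multiplied by [B ^ -max] so that every scale contributes equally to the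
    optimum.  Values being exchangeable, the bound holds for each arrival order. *)

Require Import Defs.
From mathcomp Require Import all_classical all_reals all_analysis.
From mathcomp Require Import all_boot all_order all_algebra all_fingroup.
From mathcomp Require Import ring lra.
Import Order.TTheory GRing.Theory Num.Theory.
Set Implicit Arguments.
Unset Strict Implicit.
Unset Printing Implicit Defensive.
Local Open Scope ring_scope.

(** * The value function of the classical secretary problem and its discretisation *)

Section ThresholdValue.
Variable R : realType.
Implicit Types (x y : R) (t j : nat).

Let e1 : R := (expR 1)^-1.

Definition threshold_value x : R := if x <= e1 then e1 else - (x * ln x).

Lemma inv_expR1_gt0 : 0 < (expR 1)^-1 :> R.
Proof. by rewrite invr_gt0 expR_gt0. Qed.

Let ln_e1 : ln e1 = -1.
Proof. by rewrite lnV ?posrE ?expR_gt0// expRK. Qed.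

Let ln_le x : 0 < x -> ln x <= x - 1.
Proof.
move=> x0; have := @le_ln1Dx R (x - 1).
by rewrite addrCA subrr addr0; apply; lra.
Qed.

(** The function $-x \ln x$ peaks at $1/e$ with value $1/e$, by $\ln y \le y - 1$ at $y =
    1/(ex)$. *)
Lemma entropy_le_threshold_value x : 0 < x -> - (x * ln x) <= threshold_value x.
Proof.
move=> x0; rewrite /threshold_value; case: ifPn => // _.
have e0 := inv_expR1_gt0.
have := @ln_le (e1 / x) (divr_gt0 e0 x0).
rewrite ln_div ?posrE// ln_e1 => H.
have : x * (-1 - ln x) <= x * (e1 / x - 1) by rewrite ler_pM2l.
rewrite mulrBr mulrBr mulrN1 !mulr1 mulrCA divff ?gt_eqF// mulr1; lra.
Qed.

Lemma threshold_value_ge0 x : x <= 1 -> 0 <= threshold_value x.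
Proof.
have e0 := inv_expR1_gt0.
move=> x1; rewrite /threshold_value; case: ifPn => [_|]; first exact: ltW.
rewrite -ltNge => ex; have x0 := lt_trans e0 ex.
rewrite oppr_ge0 pmulr_rle0//; have := ln_le x0; lra.
Qed.

(** The second part discretises the differential equation $V' = (V - x)/x$ of $V(x) = -x \ln x$,
    with second-order error [h ^+ 2 / x]. *)
Lemma threshold_value_step x h : 0 < h -> h <= x ->
  threshold_value x <= threshold_value (x - h) /\
  (e1 < x -> h < x ->
   threshold_value x + (x - threshold_value x) * (h / x) - h ^+ 2 / x <=
   threshold_value (x - h)).
Proof.
move=> h0 hx; have e0 := inv_expR1_gt0; rewrite -/e1 in e0.
have x0 : 0 < x by lra.
have lnstep : h < x -> ln (x - h) <= ln x - h / x.
  move=> hx'; have := @ln_le ((x - h) / x) (divr_gt0 _ x0).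
  rewrite subr_gt0 => /(_ hx'); rewrite ln_div ?posrE//; last by lra.
  rewrite mulrBl divff ?gt_eqF//; lra.
split; last first.
  move=> ex hx'; apply: le_trans (entropy_le_threshold_value _); last by lra.
  rewrite /threshold_value (leNgt x e1) ex /=.
  have /(ler_wpM2l (_ : 0 <= x - h)) := lnstep hx'.
  have -> : 0 <= x - h by lra.
  move=> /(_ isT).
  have -> : (x - h) * (ln x - h / x) = x * ln x - h * ln x - h + h ^+ 2 / x.
    by field; rewrite gt_eqF.
  have -> : (x - - (x * ln x)) * (h / x) = h + h * ln x by field; rewrite gt_eqF.
  lra.
have [xe|ex] := leP x e1.
  by rewrite /threshold_value xe (le_trans _ xe)//; lra.
have [ae|ea] := leP (x - h) e1.
  rewrite {2}/threshold_value ae /threshold_value (leNgt x e1) ex /=.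
  have := entropy_le_threshold_value x0; have := @ln_le (e1 / x) (divr_gt0 e0 x0).
  rewrite ln_div ?posrE// ln_e1 => H _.
  have : x * (-1 - ln x) <= x * (e1 / x - 1) by rewrite ler_pM2l.
  rewrite mulrBr mulrBr mulrN1 !mulr1 mulrCA divff ?gt_eqF// mulr1; lra.
have hx' : h < x by lra.
apply: le_trans (entropy_le_threshold_value _); last by lra.
rewrite /threshold_value (leNgt x e1) ex /=.
set a := x - h in ea *.
have a0 : 0 < a by lra.
have : ln e1 <= ln a by rewrite ler_ln ?posrE// ltW.
rewrite ln_e1 => la.
have := @ln_le (a / x) (divr_gt0 a0 x0); rewrite ln_div ?posrE// => H.
have H1 : a * (ln a - ln x) <= a * (a / x - 1) by rewrite ler_pM2l.
have H2 : h * (1 - a / x - 1) <= h * ln x by rewrite ler_pM2l//; lra.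
have H3 : a * (a / x - 1) = - (h * (a / x)) by rewrite /a; field; rewrite gt_eqF.
have xE : x * ln x = a * ln x + h * ln x by rewrite /a; ring.
rewrite mulrBr H3 in H1; lra.
Qed.

(* A discrete supersolution of the optimal stopping recursion of the classical
   secretary problem with [t] candidates: the additive [1 / t] absorbs the
   discretisation error of the continuous value function. *)
Definition stopping_value t j : R := threshold_value (j%:R / t%:R) + t%:R^-1.

Lemma stopping_value0 t : stopping_value t 0 = e1 + t%:R^-1.
Proof. by rewrite /stopping_value mul0r /threshold_value ltW ?inv_expR1_gt0. Qed.

Lemma stopping_value_ge0 t j : (j <= t)%N -> 0 <= stopping_value t j.
Proof.
move=> jt; rewrite addr_ge0 ?invr_ge0// threshold_value_ge0//.
case: t jt => [|t] jt; first by rewrite invr0 mulr0.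
by rewrite ler_pdivrMr// mul1r ler_nat.
Qed.

(** Backward induction multiplied by [j.+1]: the next candidate is a record with probability
    $1/(j+1)$ and is then the overall maximum with probability $(j+1)/t$. Above $1/e$, the error
    [h ^+ 2 / x] of [threshold_value_step] becomes [h] after multiplication by [x / h], which is
    what the additive [1 / t] pays for. *)
Lemma stopping_value_rec t j : (j < t)%N ->
  j.+1%:R * stopping_value t j >=
  j%:R * stopping_value t j.+1 + Num.max (stopping_value t j.+1) (j.+1%:R / t%:R).
Proof.
move=> jt; have e0 := inv_expR1_gt0; rewrite -/e1 in e0.
have t0 : 0 < t%:R :> R by rewrite ltr0n (leq_ltn_trans _ jt).
pose h : R := t%:R^-1; have h0 : 0 < h by rewrite invr_gt0.
pose x : R := j.+1%:R / t%:R.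
have xh : x - h = j%:R / t%:R by rewrite /x /h -natr1; field; rewrite gt_eqF.
have hx : h <= x by rewrite -subr_ge0 xh divr_ge0.
have x0 : 0 < x by lra.
have [mono step] := threshold_value_step h0 hx.
rewrite /stopping_value -/h -/x -xh.
have -> : j.+1%:R = x / h :> R by rewrite /x /h; field; rewrite gt_eqF.
have -> : j%:R = x / h - 1 :> R by rewrite /x /h -natr1; field; rewrite gt_eqF.
set u := threshold_value x in mono step *; set v := threshold_value (x - h) in mono step *.
have xh1 : 1 <= x / h by rewrite ler_pdivlMr// mul1r.
have mono' : x / h * (u + h) <= x / h * (v + h) by rewrite ler_pM2l ?lerD2r// divr_gt0.
rewrite addrC -lerBrDr ge_max; apply/andP; split; first by lra.
have [xe|ex] := leP x e1.
  have ue : u = e1 by rewrite /u /threshold_value xe.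
  rewrite ue in mono' *; lra.
(* For [j = 0] the point [x - h] is 0 and [step] does not apply; there the coefficient [x / h - 1]
   of the waiting value vanishes. *)
have hxlt : j = 0%N \/ h < x.
  case: (posnP j) => [->|jp]; [by left|right].
  by rewrite -subr_gt0 xh divr_gt0// ltr0n.
case: hxlt => [j0|hx'].
  have xeh : x = h by apply/eqP; rewrite -subr_eq0 xh j0 mul0r.
  have : e1 <= v.
    by rewrite /v xeh subrr /threshold_value (ltW e0).

  move=> ev; rewrite xeh divff ?gt_eqF//.
  suff : 0 <= v by lra.
  lra.
have := step ex hx'.
rewrite -(ler_pM2l (_ : 0 < x / h)); last by rewrite divr_gt0.
have -> : x / h * (u + (x - u) * (h / x) - h ^+ 2 / x) = x / h * u + x - u - h.
  by field; rewrite !gt_eqF.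
have -> : x / h * (v + h) = x / h * v + x by field; rewrite gt_eqF.
have -> : (x / h - 1) * (u + h) = x / h * u + x - u - h by field; rewrite gt_eqF.
lra.
Qed.

End ThresholdValue.

(** * Sums over the continuations of a sequence of values *)

Section IteratedSum.
Variables (R : realType) (N : nat).
Implicit Types (ys zs : seq 'I_N) (Phi : seq 'I_N -> R).

Fixpoint sum_ext n Phi ys : R :=
  if n is n'.+1 then \sum_(v : 'I_N) sum_ext n' Phi (v :: ys) else Phi ys.

Lemma sum_ext_ge0 n Phi ys : (forall zs, 0 <= Phi zs) -> 0 <= sum_ext n Phi ys.
Proof. by move=> p; elim: n ys => [|n IH] ys //=; apply: sumr_ge0 => v _. Qed.

(** Shifted by one, so that the empty sequence gets 0 and [v] is a record after [ys] exactly when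
    [seqmax ys <= v]. *)
Definition seqmax ys : nat := \max_(v <- ys) v.+1.

Lemma seqmax_cons v ys : seqmax (v :: ys) = maxn v.+1 (seqmax ys).
Proof. by rewrite /seqmax big_cons. Qed.

Lemma mem_le_seqmax v ys : v \in ys -> (v < seqmax ys)%N.
Proof. by move=> vs; rewrite /seqmax (big_rem v)//= leq_maxl. Qed.

Lemma seqmax_le ys : (seqmax ys <= N)%N.
Proof.
elim: ys => [|v ys IH]; first by rewrite /seqmax big_nil.
by rewrite seqmax_cons geq_max ltn_ord.
Qed.

Lemma count_lt (m : nat) : (m <= N)%N -> #|[pred v : 'I_N | v < m]%N| = m.
Proof.
by move=> mN; rewrite -sum1_card (big_ord_narrow mN) sum1_card card_ord.
Qed.

Lemma uniq_size_seqmax ys : uniq ys -> (size ys <= seqmax ys)%N.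
Proof.
move=> /card_uniqP <-; rewrite -[leqRHS](count_lt (seqmax_le ys)).
by apply/subset_leq_card/subsetP => v /mem_le_seqmax.
Qed.

(* The values that can follow [ys] without a repetition are the
   [seqmax ys - size ys] fresh ones below the running maximum and the records. *)
Lemma sum_fresh ys (a : R) (b : nat -> R) (g : 'I_N -> R) : uniq ys ->
  (forall v, v \in ys -> g v = 0) ->
  (forall v : 'I_N, v \notin ys -> (v < seqmax ys)%N -> g v = a) ->
  (forall v : 'I_N, (seqmax ys <= v)%N -> g v = b v) ->
  \sum_v g v = (seqmax ys - size ys)%N%:R * a + \sum_(seqmax ys <= z < N) b z.
Proof.
move=> us g0 ga gb; rewrite (bigID (fun v : 'I_N => v < seqmax ys)%N) /=; congr +%R.
  rewrite (bigID (mem ys)) /= big1 ?add0r => [|v /andP[_ /g0]//].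
  under eq_bigr => v /andP[vs vy] do rewrite (ga v vy vs).
  rewrite sumr_const mulr_natl; congr (_ *+ _).
  have := cardID (mem ys) [pred v : 'I_N | v < seqmax ys]%N.
  rewrite (count_lt (seqmax_le ys)).
  have -> : #|[predI [pred v : 'I_N | (v < seqmax ys)%N] & mem ys]| = size ys.
    rewrite -(card_uniqP us); apply: eq_card => v; rewrite !inE.
    by rewrite andb_idl// => /mem_le_seqmax.
  move=> /(canRL (addKn _)) <-.
  by apply: eq_card => v; rewrite !inE andbC.
rewrite (@big_nat_widenl _ _ _ _ 0)//= big_mkord.
by apply: eq_big => v; rewrite -leqNgt// => vs; rewrite gb.
Qed.

End IteratedSum.

(** * The truncated scale-free prior and its marginals *)

Section ScaleFreePrior.
Variables (R : realType) (N t : nat).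
Implicit Types (ys zs : seq 'I_N).

(* Mass of a prefix of [j] distinct values with maximum [m]; junk for [j = 0],
   where the untruncated prior has infinite mass. *)
Definition prefix_mass j m : R := (j%:R * (m ^_ j)%:R)^-1.

Lemma prefix_mass_ge0 j m : 0 <= prefix_mass j m.
Proof. by rewrite invr_ge0 mulr_ge0. Qed.

Let ffact_neq0 m j : (j <= m)%N -> (m ^_ j)%:R != 0 :> R.
Proof. by rewrite pnatr_eq0 -lt0n ffact_gt0. Qed.

(** For [j > 0] the right-hand side is $j/(j+1)$ times [prefix_mass j m]: the probability of a
    non-record does not depend on the history. *)
Lemma prefix_mass_nonrecord j m : (j < m)%N ->
  (m - j)%:R * prefix_mass j.+1 m = (j.+1%:R * (m ^_ j)%:R)^-1.
Proof.
move=> jm; rewrite /prefix_mass ffactnSr natrM.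
by field; rewrite nat1r !ffact_neq0 ?pnatr_eq0 ?subn_eq0 -?ltnNge ?(ltnW jm).
Qed.

Lemma prefix_mass_nonrecord_le j m : (j <= m)%N ->
  (m - j)%:R * prefix_mass j.+1 m <= (j.+1%:R * (m ^_ j)%:R)^-1.
Proof.
rewrite leq_eqVlt => /predU1P[->|/prefix_mass_nonrecord->//].
by rewrite subnn mul0r invr_ge0 mulr_ge0.
Qed.

(** The terms telescope as differences of $1/z^{\underline{j}}$. The part without [N] is
    [prefix_mass j m] divided by $j+1$; the other is the loss by truncation. *)
Lemma prefix_mass_record j m : (0 < j)%N -> (j <= m <= N)%N ->
  \sum_(m <= z < N) prefix_mass j.+1 z.+1 =
  (j%:R * j.+1%:R)^-1 * ((m ^_ j)%:R^-1 - (N ^_ j)%:R^-1).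
Proof.
move=> j0 /andP[jm mN].
rewrite -opprB -(@telescope_sumr _ m N (fun z => (z ^_ j)%:R^-1))// mulrN mulr_sumr -sumrN.
apply: eq_big_nat => z /andP[mz _]; have jz := leq_trans jm mz.
rewrite /prefix_mass ffactSS.
have E : (z.+1 ^_ j * (z.+1 - j) = z.+1 * z ^_ j)%N by rewrite -ffactnSr ffactSS.
have {}E : (z.+1 ^_ j)%:R = z.+1%:R * (z ^_ j)%:R / (z.+1%:R - j%:R) :> R.
  rewrite -natrM -E natrM natrB ?(leqW jz)// mulfK// subr_eq0 eqr_nat.
  by rewrite gtn_eqF// ltnS.
rewrite E natrM; field.
rewrite !nat1r !ffact_neq0 ?pnatr_eq0 -?lt0n ?j0//=.
by rewrite -natr1 addrAC -natrB// natr1 pnatr_eq0.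
Qed.

(* Up to the truncation at [N], this is the law of [t] distinct values drawn
   uniformly below a random scale [theta] of improper weight [1 / (theta + 1)];
   this choice makes the marginals [prefix_mass] exact and the probability of a
   record at step [j] equal to [1 / j] whatever the values seen so far. *)
Definition prior ys : R := if uniq ys then prefix_mass t (seqmax ys) else 0.

Lemma prior_ge0 ys : 0 <= prior ys.
Proof. by rewrite /prior; case: ifP; rewrite ?prefix_mass_ge0. Qed.

Lemma prior_perm ys zs : perm_eq ys zs -> prior ys = prior zs.
Proof.
by move=> yz; rewrite /prior (perm_uniq yz) /seqmax (perm_big _ yz).
Qed.

Lemma sum_ext_not_uniq n (g : seq 'I_N -> R) ys : ~~ uniq ys ->
  (forall zs, ~~ uniq zs -> g zs = 0) -> sum_ext n g ys = 0.
Proof.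
move=> nu g0; elim: n ys nu => [|n IH] ys nu /=; first exact: g0.
by apply: big1 => v _; apply: IH; rewrite /= negb_and nu orbT.
Qed.

Lemma prior_not_uniq zs : ~~ uniq zs -> prior zs = 0.
Proof. by rewrite /prior => /negbTE->. Qed.

Lemma sum_ext_not_max n (a : nat) ys : (a < seqmax ys)%N ->
  sum_ext n (fun zs => prior zs * (seqmax zs == a)%:R) ys = 0.
Proof.
elim: n ys => [|n IH] ys aq /=; first by rewrite gtn_eqF ?mulr0.
by apply: big1 => v _; apply: IH; rewrite seqmax_cons leq_max aq orbT.
Qed.

(** The current maximum survives all later draws: the non-record probabilities $j/(j+1), \dots,
    (t-1)/t$ multiply to $j/t$. *)
Lemma sum_ext_max n ys : (n + size ys = t)%N -> uniq ys ->
  sum_ext n (fun zs => prior zs * (seqmax zs == seqmax ys)%:R) ys <=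
  (t%:R * (seqmax ys ^_ size ys)%:R)^-1.
Proof.
elim: n ys => [|n IH] ys /= nt us.
  by rewrite eqxx mulr1 /prior us /prefix_mass -nt.
pose b := (t%:R * (seqmax ys ^_ (size ys).+1)%:R)^-1 : R.
have jm := uniq_size_seqmax us.
have H : \sum_(v < N) sum_ext n (fun zs => prior zs * (seqmax zs == seqmax ys)%:R) (v :: ys)
  <= \sum_(v < N) if (v \notin ys) && (v < seqmax ys)%N then b else 0.
  apply: ler_sum => v _; have [vy|vy] /= := boolP (v \in ys).
    by rewrite sum_ext_not_uniq ?(lexx, vy)//= ?vy// => zs /prior_not_uniq->; rewrite mul0r.
  case: ltnP => vs; last by rewrite sum_ext_not_max// seqmax_cons leq_max ltnS vs.
  have E : seqmax (v :: ys) = seqmax ys by rewrite seqmax_cons; apply/maxn_idPr.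
  have := IH (v :: ys); rewrite E /= vy us; apply => //.
  by rewrite addnS.
apply: le_trans H _.
rewrite (@sum_fresh _ _ ys b (fun=> 0))//; first last.
- by move=> v; rewrite leqNgt => /negbTE ->; rewrite andbF.
- by move=> v -> ->.
- by move=> v ->.
rewrite big1// addr0 /b ffactnSr natrM.
(* If all values up to the maximum are used, no non-record can follow, and the bound need not be
   tight. *)
have [E|jlt] := eqVneq (size ys) (seqmax ys).
  by rewrite E subnn mul0r invr_ge0 mulr_ge0.
have d0 : (seqmax ys - size ys)%:R != 0 :> R by rewrite pnatr_eq0 subn_eq0 -ltnNge ltn_neqAle jlt.
by rewrite mulrA invfM mulrCA divff// mulr1.
Qed.

(** Truncation removes $(1/j - 1/(j+1))/N^{\underline{j}}$ at step $j$. Each of the $N - j$ fresh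
    values inherits the later loss [gam], and the losses telescope to $1/j - 1/t$. *)
Lemma sum_ext_prior_ge n ys : (n + size ys = t)%N -> uniq ys -> (0 < size ys)%N ->
  (t <= seqmax ys)%N ->
  prefix_mass (size ys) (seqmax ys) - ((size ys)%:R^-1 - t%:R^-1) / (N ^_ size ys)%:R
  <= sum_ext n prior ys.
Proof.
elim: n ys => [|n IH] ys /= nt us ys0 tm.
  by rewrite /prior us -nt subrr mul0r subr0.
pose j := size ys; rewrite -/j.
have mN := seqmax_le ys.
have jm : (j < seqmax ys)%N by rewrite (leq_trans _ tm)// -nt addSn ltnS leq_addl.
have jN : (j < N)%N := leq_trans jm mN.
pose gam : R := (j.+1%:R^-1 - t%:R^-1) / (N ^_ j.+1)%:R.
pose low (v : 'I_N) := if v \in ys then 0 else prefix_mass j.+1 (maxn v.+1 (seqmax ys)) - gam.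
have H : \sum_v low v <= \sum_v sum_ext n prior (v :: ys).
  apply: ler_sum => v _; rewrite /low; have [vy|vy] := boolP (v \in ys).
    by rewrite sum_ext_not_uniq ?(lexx, vy)//= ?vy//; exact: prior_not_uniq.
  rewrite -seqmax_cons; apply: (IH (v :: ys)) => //=.
  - by rewrite addnS -nt.
  - by rewrite vy.
  - by rewrite seqmax_cons leq_max tm orbT.
apply: le_trans H.
rewrite (@sum_fresh _ _ ys (prefix_mass j.+1 (seqmax ys) - gam)
   (fun z => prefix_mass j.+1 z.+1 - gam))//; first last.
- move=> v sv; rewrite /low; case: ifP => [/mem_le_seqmax|_]; first by rewrite ltnNge sv.
  by rewrite (maxn_idPl _)// leqW.
- by move=> v vy vs; rewrite /low (negbTE vy) (maxn_idPr _).
- by move=> v vy; rewrite /low vy.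
rewrite -/j mulrBr prefix_mass_nonrecord// sumrB prefix_mass_record ?(ltnW jm)//.
rewrite sumr_const_nat.
have -> : gam *+ (N - seqmax ys) = (N - seqmax ys)%:R * gam by rewrite mulr_natl.
rewrite !natrB ?(ltnW jm)// /gam /prefix_mass.
have NE : (N ^_ j.+1)%:R = (N ^_ j)%:R * (N%:R - j%:R) :> R.
  by rewrite ffactnSr natrM natrB ?(ltnW jN).
rewrite NE le_eqVlt; apply/orP; left; apply/eqP.
field; rewrite !nat1r !ffact_neq0 ?(ltnW jm) ?(ltnW jN)//.
rewrite !pnatr_eq0 -!lt0n ys0 /= -natrB ?(ltnW jN)// pnatr_eq0 subn_eq0 -ltnNge jN.
by rewrite -nt.
Qed.

Definition harmonic_sum : R := \sum_(0 <= z < N) z.+1%:R^-1.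

(** First values below [t.-1] are dropped at a cost of at most [t]; every other one loses at most
    $1/N$ by truncation, in total at most 1. *)
Lemma sum_ext_prior0_ge : (0 < t <= N)%N ->
  harmonic_sum - (t%:R + 1) <= sum_ext t prior [::].
Proof.
case/andP=> t0 tN; rewrite /harmonic_sum (big_cat_nat _ _ (n := t.-1))//=; last first.
  by rewrite (leq_trans _ tN) ?leq_pred.
have H1 : \sum_(0 <= z < t.-1) z.+1%:R^-1 <= t%:R :> R.
  apply: (@le_trans _ _ (\sum_(0 <= z < t.-1) 1)).
    by apply: ler_sum => z _; rewrite invf_le1 ?ltr0n// ler1n.
  by rewrite sumr_const_nat subn0 ler_nat leq_pred.
suff : \sum_(t.-1 <= z < N) z.+1%:R^-1 - 1 <= sum_ext t prior [::] by lra.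
have N0 : (0 < N)%N := leq_trans t0 tN.
apply: (@le_trans _ _ (\sum_(t.-1 <= z < N) (z.+1%:R^-1 - N%:R^-1))).
  rewrite sumrB lerD2l lerN2 sumr_const_nat -[X in X <= _]mulr_natl.
  by rewrite ler_pdivrMr ?ltr0n// mul1r ler_nat leq_subr.
have tE := prednK t0; rewrite -{2}tE /= (@big_nat_widenl _ _ _ _ 0)//= big_mkord.
rewrite [leRHS](bigID (fun v : 'I_N => t.-1 <= v)%N) /= -[leLHS]addr0 lerD//; last first.
  by apply: sumr_ge0 => v _; apply: sum_ext_ge0; exact: prior_ge0.
apply: ler_sum => v tv.
have := @sum_ext_prior_ge t.-1 [:: v]; rewrite /= addn1 tE => /(_ erefl isT isT).
rewrite /prefix_mass {1 2}/seqmax big_seq1 -[leqLHS]tE ltnS => /(_ tv).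
rewrite mul1r !ffactn1; apply: le_trans; rewrite lerD2l lerN2 invr1.
by rewrite ler_piMl ?invr_ge0// lerBlDr lerDl invr_ge0.
Qed.

End ScaleFreePrior.

(** * Sums over value assignments, redrawing one coordinate at a time *)

Section Updates.
Variables (R : comPzRingType) (T : finType) (N : nat).
Implicit Types (x y : {ffun T -> 'I_N}) (F G : {ffun T -> 'I_N} -> R) (l : seq T).

Definition upd x e v : {ffun T -> 'I_N} := [ffun e' => if e' == e then v else x e'].

Lemma upd_id x e v : upd x e v e = v. Proof. by rewrite ffunE eqxx. Qed.

Lemma upd_neq x e v e' : e' != e -> upd x e v e' = x e'.
Proof. by rewrite ffunE => /negbTE->. Qed.

Lemma map_upd x e v l : e \notin l -> map (upd x e v) l = map x l.
Proof.
move=> el; apply/eq_in_map => e' e'l; apply: upd_neq.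
by apply: contraNneq el => <-.
Qed.

Fixpoint sum_upd l F x : R :=
  if l is e :: l' then \sum_(v : 'I_N) sum_upd l' F (upd x e v) else F x.

Lemma eq_sum_upd l F G x :
  (forall y, (forall e, e \notin l -> y e = x e) -> F y = G y) ->
  sum_upd l F x = sum_upd l G x.
Proof.
elim: l x => [|e l IH] x FG /=; first exact: FG.
apply: eq_bigr => v _; apply: IH => y yx; apply: FG => e'.
by rewrite inE negb_or => /andP[e'e /yx->]; apply: upd_neq.
Qed.

Lemma sum_upd_lin l (a b : R) F G x :
  sum_upd l (fun y => a * F y + b * G y) x = a * sum_upd l F x + b * sum_upd l G x.
Proof.
elim: l x => [|e l IH] x //=; rewrite !mulr_sumr -big_split.
by apply: eq_bigr => v _; exact: IH.
Qed.

Lemma sum_upd_mul l (K : {ffun T -> 'I_N} -> R) F x :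
  (forall y e v, e \in l -> K (upd y e v) = K y) ->
  sum_upd l (fun y => K y * F y) x = K x * sum_upd l F x.
Proof.
elim: l x => [|e l IH] x Kl //=; rewrite mulr_sumr; apply: eq_bigr => v _.
by rewrite IH ?Kl ?mem_head// => y e' u e'l; apply: Kl; rewrite inE e'l orbT.
Qed.

(** Exchanging the drawn value with the old one is an involution, so each redraw contributes a
    factor [N]. This lets one block be summed in arrival order while the others are frozen. *)
Lemma sum_sum_upd l F : \sum_x sum_upd l F x = (N ^ size l)%:R * \sum_x F x.
Proof.
elim: l F => [|e l IH] F /=; first by rewrite expn0 mul1r.
transitivity (\sum_x \sum_(v : 'I_N) sum_upd l F x).
  rewrite !pair_big /=.
  rewrite [RHS](reindex_inj (h := fun p => (upd p.1 e p.2, p.1 e)))//=.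
  apply: inv_inj => -[x v] /=; rewrite upd_id; congr pair.
  by apply/ffunP => e'; rewrite !ffunE; case: eqP => [->|].
rewrite exchange_big /= sumr_const card_ord IH.
by rewrite -mulrnAl -mulrnA expnSr.
Qed.

End Updates.

Section UpdatesReal.
Variables (R : realType) (T : finType) (N : nat).
Implicit Types (x y : {ffun T -> 'I_N}) (F G : {ffun T -> 'I_N} -> R) (l : seq T).

Lemma le_sum_upd l F G x :
  (forall y, (forall e, e \notin l -> y e = x e) -> F y <= G y) ->
  sum_upd l F x <= sum_upd l G x.
Proof.
elim: l x => [|e l IH] x FG /=; first exact: FG.
apply: ler_sum => v _; apply: IH => y yx; apply: FG => e'.
by rewrite inE negb_or => /andP[e'e /yx->]; apply: upd_neq.
Qed.

(** Passage from assignments to sequences; [catrev] appears because the newest value stands in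
    front. *)
Lemma sum_upd_ext l seen (Phi : seq 'I_N -> R) x : uniq (catrev l seen) ->
  sum_upd l (fun y => Phi (map y (catrev l seen))) x =
  sum_ext (size l) Phi (map x seen).
Proof.
elim: l seen x => [|e l IH] seen x //= u; apply: eq_bigr => v _.
rewrite IH//= upd_id map_upd//.
by move: u; rewrite catrevE cat_uniq => /and3P[_ _ /= /andP[]].
Qed.

End UpdatesReal.

(** * Backward induction for a single block *)

Section Stopping.
Variables (R : realType) (N t : nat).
Implicit Types (ys zs : seq 'I_N).

(** The untruncated mass of a prefix; the empty one, whose mass would be infinite, gets the sum of
    [potential [:: v]] over [v]. *)
Definition potential ys : R :=
  if uniq ys then
    if ys is [::] then harmonic_sum R N else prefix_mass R (size ys) (seqmax ys)
  else 0.

Lemma potential_ge0 ys : 0 <= potential ys.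
Proof.
rewrite /potential; case: ifP => // _; case: ys => [|v ys]; last exact: prefix_mass_ge0.
by apply: sumr_ge0.
Qed.

Lemma seqmax_mem (v : 'I_N) ys : v.+1 = seqmax ys -> v \in ys.
Proof.
elim: ys => [|u ys IH]; first by rewrite /seqmax big_nil.
rewrite seqmax_cons inE; case: leqP => _ E; first by rewrite IH ?orbT.
by case: E => /val_inj ->; rewrite eqxx.
Qed.

Definition reward_or_wait ys (v : 'I_N) : R :=
  if (seqmax ys <= v)%N then
    Num.max (stopping_value R t (size ys).+1) ((size ys).+1%:R / t%:R)
  else stopping_value R t (size ys).+1.

(** For nonempty [ys], non-records carry at most $j/(j+1)$ of the potential and records at most
    $1/(j+1)$, which reduces the claim to [stopping_value_rec]. *)
Lemma potential_step ys : (size ys < t)%N ->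
  \sum_v potential (v :: ys) * reward_or_wait ys v <=
  stopping_value R t (size ys) * potential ys.
Proof.
move=> jt; have [us|us] := boolP (uniq ys); last first.
  by rewrite big1 => [|v _]; rewrite /potential /= ?(negbTE us) ?andbF ?(mulr0, mul0r).
set j := size ys in jt *; pose U := stopping_value R t j.+1.
pose M := Num.max U (j.+1%:R / t%:R).
rewrite (@sum_fresh _ _ ys (prefix_mass R j.+1 (seqmax ys) * U)
  (fun z => prefix_mass R j.+1 z.+1 * M))//; first last.
- move=> v sv; rewrite /reward_or_wait sv /potential /= us andbT.
  case: ifPn => [_|/negPn/mem_le_seqmax]; last by rewrite ltnNge sv.
  by rewrite seqmax_cons (maxn_idPl _)// leqW.
- move=> v vy vs; rewrite /reward_or_wait leqNgt vs /potential /= us vy /=.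
  by rewrite seqmax_cons (maxn_idPr _).
- by move=> v vy; rewrite /potential /= vy mul0r.
have := stopping_value_rec R jt; rewrite -/U -/M => rec.
have U0 : 0 <= U by apply: stopping_value_ge0.
have jm := uniq_size_seqmax us; have mN := seqmax_le ys.
rewrite -mulr_suml mulrA -/j /potential us.
have [ys0|ys_n0] := eqVneq ys [::].
  have m0 : seqmax ys = 0%N by rewrite ys0 /seqmax big_nil.
  rewrite m0 sub0n !mul0r add0r ys0 mulrC.
  move: rec; rewrite /j ys0 mul0r mul1r add0r => rec.
  under eq_bigr do rewrite /prefix_mass mul1r ffactn1.
  by rewrite ler_wpM2r// /harmonic_sum sumr_ge0.
have j0 : (0 < j)%N by rewrite /j lt0n size_eq0.
have -> : (if ys is [::] then harmonic_sum R N else prefix_mass R j (seqmax ys))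
   = prefix_mass R j (seqmax ys) by case: (ys) ys_n0.
rewrite prefix_mass_record ?jm//.
set D : R := (seqmax ys ^_ j)%:R.
have D0 : 0 < D by rewrite ltr0n ffact_gt0.
have M0 : 0 <= M by rewrite le_max U0.
have H1 := @prefix_mass_nonrecord_le R j (seqmax ys) jm.
apply: (@le_trans _ _ ((j.+1%:R * D)^-1 * U + (j%:R * j.+1%:R)^-1 * D^-1 * M)).
  apply: lerD; first exact: ler_wpM2r.
  by rewrite ler_wpM2r// ler_wpM2l ?invr_ge0 ?mulr_ge0// gerBl invr_ge0.
rewrite /prefix_mass -/D.
have -> : (j.+1%:R * D)^-1 * U + (j%:R * j.+1%:R)^-1 * D^-1 * M =
  (j%:R * D)^-1 * (j.+1%:R^-1 * (j%:R * U + M)).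
  have jne : j%:R != 0 :> R by rewrite pnatr_eq0 -lt0n.
  by field; rewrite nat1r (pnatr_eq0 _ j.+1) jne -/D (gt_eqF D0).
rewrite [leRHS]mulrC; apply: ler_wpM2l; first by rewrite invr_ge0 mulr_ge0 ?(ltW D0).
by rewrite ler_pdivrMl ?ltr0n.
Qed.

(** Taking [v] pays when [v] is the final maximum: impossible for a non-record, and bounded by
    [sum_ext_max] for a record. *)
Lemma record_mass n ys (v : 'I_N) : (n + (size ys).+1 = t)%N ->
  sum_ext n (fun zs => prior R t zs * (seqmax zs == v.+1)%:R) (v :: ys) <=
  potential (v :: ys) *
    (if (seqmax ys <= v)%N then (size ys).+1%:R / t%:R else 0).
Proof.
move=> nt; have [us|us] := boolP (uniq (v :: ys)); last first.
  rewrite sum_ext_not_uniq// => [|zs /prior_not_uniq->]; last by rewrite mul0r.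
  by rewrite /potential (negbTE us) mul0r.
case: leqP => vs.
  have E : seqmax (v :: ys) = v.+1 by rewrite seqmax_cons (maxn_idPl _)// leqW.
  have := @sum_ext_max R N t n (v :: ys) nt us; rewrite E => /le_trans; apply.
  rewrite /potential us E /prefix_mass /= le_eqVlt; apply/orP; left; apply/eqP.
  have D0 : (v.+1 ^_ (size ys).+1)%:R != 0 :> R.
    by rewrite pnatr_eq0 -lt0n ffact_gt0 -E; exact: (uniq_size_seqmax us).
  have t0 : t%:R != 0 :> R by rewrite -nt addnS pnatr_eq0.
  by field; rewrite D0 t0 nat1r pnatr_eq0.
rewrite mulr0 sum_ext_not_max// seqmax_cons leq_max ltnn /= ltn_neqAle vs andbT.
by apply/eqP => /seqmax_mem vy; move: us; rewrite /= vy.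
Qed.

End Stopping.

(** * Reduction of an online algorithm to stopping in single blocks *)

Section Online.
Variables (R : realType) (n m : nat) (blk : 'I_n -> 'I_m).
Variables (F : {set {set 'I_n}}) (A : algorithm R n).
Hypothesis validA : valid_algorithm A.
Implicit Types (w : 'I_n -> R) (h : history R n) (S : {set 'I_n}) (i : 'I_m).

Definition accept_prob h S e x : R := if e |: S \in F then A h e x else 0.

Lemma accept_prob01 h S e x : 0 <= accept_prob h S e x <= 1.
Proof. by rewrite /accept_prob; case: ifP => _; rewrite ?lexx ?ler01. Qed.

(* The recursion stops at the first acceptance in block [i]: this is the payoff
   of a single-choice algorithm that simulates all the other blocks. *)
Fixpoint first_reward w i h S (rest : seq 'I_n) : R :=
  if rest is e :: rest' then
    let p := accept_prob h S e (w e) in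
    p * (if blk e == i then w e
         else first_reward w i (rcons h (e, w e, true)) (e |: S) rest')
    + (1 - p) * first_reward w i (rcons h (e, w e, false)) S rest'
  else 0.

(** Induction on arrivals. Accepting in a block already hit lowers [k + #|blk @: S| - #|S|] by one
    and releases [W], at least the weight gained. Accepting in a new block keeps this budget and
    earns the [first_reward] of that block. *)
Lemma run_le_first_rewards (k : nat) (W : R) w : 0 <= W ->
  (forall S, S \in F -> (#|S| <= #|blk @: S| + k)%N) ->
  (forall e, 0 <= w e <= W) ->
  forall rest h S, uniq rest -> {in rest, forall e, e \notin S} -> S \in F ->
  run F A w h S rest <=
    wsum w S + \sum_(i | i \notin blk @: S) first_reward w i h S rest
    + W * (k%:R + #|blk @: S|%:R - #|S|%:R).
Proof.
move=> W0 Fk w0W; elim=> [|e rest IH] h S /=.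
  move=> _ _ SF; rewrite big1// addr0 lerDl mulr_ge0//.
  by rewrite subr_ge0 -natrD ler_nat addnC Fk.
case/andP=> er ur rS SF; rewrite -/(accept_prob h S e (w e)).
have eS : e \notin S by rewrite rS ?mem_head.
have rS' : {in rest, forall e', e' \notin S} by move=> e' e'r; rewrite rS// inE e'r orbT.
set p := accept_prob _ _ _ _.
have /andP[p0 p1] : 0 <= p <= 1 by exact: accept_prob01.
set D := W * _.
have rej := IH (rcons h (e, w e, false)) S ur rS' SF.
set hf := rcons h (e, w e, false) in rej *; set ht := rcons h (e, w e, true).
suff acc : p * run F A w ht (e |: S) rest <= p * (wsum w S + \sum_(i | i \notin blk @: S)
    (if blk e == i then w e else first_reward w i ht (e |: S) rest) + D).
  have := lerD acc (ler_wpM2l (_ : 0 <= 1 - p) rej); rewrite subr_ge0 => /(_ p1).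
  move=> /le_trans; apply; rewrite big_split /= -!mulr_sumr -/D; lra.
rewrite /p /accept_prob; case: ifPn => [eSF|_]; last by rewrite !mul0r.
have A0 : 0 <= A h e (w e) by have /andP[] := validA h e (w e).
apply: ler_wpM2l => //.
have rS'' : {in rest, forall e', e' \notin e |: S}.
  move=> e' e'r; rewrite !inE negb_or rS' ?e'r ?andbT//.
  by apply: contraNneq er => <-.
apply: le_trans (IH ht _ ur rS'' eSF) _.
have -> : wsum w (e |: S) = w e + wsum w S by rewrite /wsum big_setU1.
rewrite cardsU1 eS imsetU1 /D.
have [bS|bS] := boolP (blk e \in blk @: S).
  have -> : blk e |: blk @: S = blk @: S by apply/setUidPr; rewrite sub1set.
  rewrite [X in _ <= _ + X + _](eq_bigr (fun i => first_reward w i ht (e |: S) rest)); last first.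
    by move=> i; case: eqP => // <-; rewrite bS.
  have /andP[_] := w0W e; rewrite natrD /=; lra.
rewrite cardsU1 bS !natrD /=.
rewrite [X in _ <= _ + X + _](bigD1 (blk e))//= eqxx.
rewrite [X in _ <= _ + (_ + X) + _](eq_bigr (fun i => first_reward w i ht (e |: S) rest)); last first.
  by move=> i /andP[_]; rewrite eq_sym => /negbTE->.
rewrite [X in _ + X + _ <= _](eq_bigl (fun i => (i \notin blk @: S) && (i != blk e))); last first.
  by move=> i; rewrite !inE negb_or andbC.
lra.
Qed.

Variables (N t B : nat) (c : 'I_m -> R).
Hypotheses (B_gt0 : (0 < B)%N) (c_ge0 : forall i, 0 <= c i).
Implicit Types (x y : {ffun 'I_n -> 'I_N}).

(** Equal values may occur in different blocks; the factor [c] serves to keep their weights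
    distinct. *)
Definition weight x (e : 'I_n) : R := c (blk e) * B%:R ^+ (x e).+1.

Definition scaled_prior (zs : seq 'I_N) : R := prior R t zs * (B%:R ^+ seqmax zs)^-1.

Let B0 : 0 < B%:R :> R. Proof. by rewrite ltr0n. Qed.

(* Weights grow so fast that accepting anything but the maximum of the block
   earns at most a fraction [1 / B] of the maximum. *)
Lemma scaled_prior_weight zs (v : 'I_N) : v \in zs ->
  scaled_prior zs * B%:R ^+ v.+1 <= prior R t zs * (seqmax zs == v.+1)%:R + B%:R^-1 * prior R t zs.
Proof.
move=> vz; rewrite /scaled_prior -mulrA [B%:R^-1 * _]mulrC -mulrDr ler_wpM2l ?prior_ge0//.
case: eqP => [->|/eqP mv]; first by rewrite mulVf ?expf_neq0 ?gt_eqF// lerDl invr_ge0 ltW.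
have vm : (v.+1 < seqmax zs)%N by rewrite ltn_neqAle eq_sym mv mem_le_seqmax.
rewrite add0r ler_pdivrMl ?exprn_gt0// ler_pdivlMr//.
by rewrite -exprSr ler_weXn2l// ler1n.
Qed.

(** Backward induction in which a value of block [i] is drawn when its element arrives, [seen] lists
    the earlier ones, and all other values are frozen in [x]. *)
Lemma first_reward_bound i rest h S seen x :
  let l := [seq e <- rest | blk e == i] in
  uniq (catrev l seen) -> (size l + size seen = t)%N ->
  sum_upd l (fun y => scaled_prior (map y (catrev l seen)) * first_reward (weight y) i h S rest) x <=
  c i * (stopping_value R t (size seen) * potential R (map x seen)
         + B%:R^-1 * sum_ext (size l) (prior R t) (map x seen)).
Proof.
elim: rest h S seen x => [|e rest IH] h S seen x /=.
  move=> _ <-; rewrite mulr0 mulr_ge0// addr_ge0// ?mulr_ge0 ?potential_ge0 ?prior_ge0//.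
    exact: stopping_value_ge0.
set l := filter _ rest in IH *.
case: ifPn => bi; last first.
  move=> u lt.
  have el : e \notin l by rewrite mem_filter (negbTE bi).
  (* The weight of [e] is fixed by [x], so the decision mixes two continuations that obey the same
     bound. *)
  pose p := accept_prob h S e (weight x e).
  have /andP[p0 p1] : 0 <= p <= 1 by exact: accept_prob01.
  rewrite (eq_sum_upd (G := fun y => p * (scaled_prior (map y (catrev l seen)) *
      first_reward (weight y) i (rcons h (e, weight x e, true)) (e |: S) rest) +
    (1 - p) * (scaled_prior (map y (catrev l seen)) *
      first_reward (weight y) i (rcons h (e, weight x e, false)) S rest))); last first.
    move=> y /(_ _ el) yx; have -> : weight y e = weight x e by rewrite /weight yx.
    rewrite -/p; ring.
  rewrite sum_upd_lin.
  have H1 := IH (rcons h (e, weight x e, true)) (e |: S) seen x u lt.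
  have H2 := IH (rcons h (e, weight x e, false)) S seen x u lt.
  have := lerD (ler_wpM2l p0 H1) (ler_wpM2l (_ : 0 <= 1 - p) H2).
  by rewrite subr_ge0 => /(_ p1) /le_trans; apply; rewrite -mulrDl addrC subrK mul1r.
move=> /= u lt.
have jt : (size seen < t)%N by rewrite -lt ltnS leq_addl.
have [el es] : e \notin l /\ e \notin seen.
  move: (u); rewrite catrevE cat_uniq => /and3P[_ /hasPn H /= /andP[-> _]]; split=> //.
  by apply: contraL (mem_head e seen) => el; apply/negP => /H; rewrite mem_rev el.
rewrite -(size_map x seen) in jt *.
apply: (@le_trans _ _ (\sum_(v < N) c i * (potential R (v :: map x seen) *
    reward_or_wait R t (map x seen) v
    + B%:R^-1 * sum_ext (size l) (prior R t) (v :: map x seen)))); last first.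
  rewrite -mulr_sumr big_split /= -mulr_sumr; apply: ler_wpM2l => //.
  by rewrite lerD2r potential_step.
apply: ler_sum => v _.
set x' := upd x e v; set ys := map x seen.
have x'e : x' e = v by exact: upd_id.
have x's : map x' (e :: seen) = v :: ys by rewrite /= x'e map_upd.
pose om := weight x' e; pose p := accept_prob h S e om.
have /andP[p0 p1] : 0 <= p <= 1 by exact: accept_prob01.
have omE : om = c i * B%:R ^+ v.+1 by rewrite /om /weight x'e (eqP bi).
rewrite (eq_sum_upd (G := fun y => p * (scaled_prior (map y (catrev l (e :: seen))) * om) +
    (1 - p) * (scaled_prior (map y (catrev l (e :: seen))) *
      first_reward (weight y) i (rcons h (e, om, false)) S rest))); last first.
  move=> y /(_ _ el) yx; have -> : weight y e = om by rewrite /om /weight yx.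
  rewrite -/p /=; ring.
rewrite sum_upd_lin.
set M := reward_or_wait _ _ _ _; set s := sum_ext _ _ _.
have P0 := potential_ge0 R (v :: ys).
have H2 := IH (rcons h (e, om, false)) S (e :: seen) x' u.
rewrite x's -/s /= addnS -addSn lt in H2; have {}H2 := H2 erefl.
have wait : stopping_value R t (size seen).+1 <= M.
  by rewrite /M /reward_or_wait size_map; case: ifP => // _; rewrite le_max lexx.
(* Acceptance is charged to the event that [v] is the final block maximum, plus the fraction
   [1 / B]. *)
have H1 : sum_upd l (fun y => scaled_prior (map y (catrev l (e :: seen))) * om) x' <=
    c i * (potential R (v :: ys) * M + B%:R^-1 * s).
  have le1 : sum_upd l (fun y => scaled_prior (map y (catrev l (e :: seen))) * om) x' <=
    sum_upd l (fun y => c i * (prior R t (map y (catrev l (e :: seen))) *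
        (seqmax (map y (catrev l (e :: seen))) == v.+1)%:R)
       + c i * B%:R^-1 * prior R t (map y (catrev l (e :: seen)))) x'.
    apply: le_sum_upd => y /(_ _ el) yx.
    rewrite omE mulrCA -mulrA -mulrDr ler_wpM2l//; apply: scaled_prior_weight.
    by rewrite -x'e -yx map_f// catrevE mem_cat mem_head orbT.
  apply: le_trans le1 _; rewrite sum_upd_lin.
  rewrite (sum_upd_ext (fun zs => prior R t zs * (seqmax zs == v.+1)%:R))//.
  rewrite (sum_upd_ext (prior R t))// x's -/s -mulrA -mulrDr ler_wpM2l// lerD2r.
  apply: le_trans (@record_mass R N t _ ys v _) _; first by rewrite /ys size_map addnS.
  rewrite ler_wpM2l// /M /reward_or_wait; case: ifP => _; first by rewrite le_max lexx orbT.
  by rewrite stopping_value_ge0.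
have H2' : c i * (stopping_value R t (size seen).+1 * potential R (v :: ys) + B%:R^-1 * s)
   <= c i * (potential R (v :: ys) * M + B%:R^-1 * s).
  by rewrite ler_wpM2l// lerD2r mulrC ler_wpM2l.
have {}H2 := le_trans H2 H2'.
have := lerD (ler_wpM2l p0 H1) (ler_wpM2l (_ : 0 <= 1 - p) H2).
by rewrite subr_ge0 => /(_ p1) /le_trans; apply; rewrite -mulrDl addrC subrK mul1r.
Qed.

End Online.

(** * The partition matroid and its union with the [k]-fold 1-uniform matroid *)

Section PartitionMatroid.
Variables (n m : nat) (blk : 'I_n -> 'I_m).
Implicit Types (S : {set 'I_n}).

Definition partition_matroid : {set {set 'I_n}} := [set S : {set 'I_n} | #|blk @: S| == #|S|].

Lemma partition_matroidP : is_matroid partition_matroid.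
Proof.
split; first by rewrite inE imset0 !cards0.
- move=> A B; rewrite !inE => /imset_injP injB /subsetP AB.
  by apply/imset_injP => e e' /AB eB /AB e'B; apply: injB.
- move=> A B; rewrite !inE => /eqP cA /eqP cB; rewrite -cA -cB => AB.
  (* [B] meets more blocks than [A], so some element of [B] lies in a block missed by [A]. *)
  have /subsetPn[_ /imsetP[x xB ->] xA] : ~~ (blk @: B \subset blk @: A).
    by apply: contraL AB => /subset_leq_card; rewrite -leqNgt.
  have xnA : x \notin A by apply: contra xA; apply: imset_f.
  by exists x; rewrite !inE ?xnA// imsetU1 !cardsU1 xA xnA cA.
Qed.

Lemma partition_matroid_loopless : loopless partition_matroid.
Proof. by move=> x; rewrite inE imset_set1 !cards1. Qed.

End PartitionMatroid.

Section KFold.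
Variable T : finType.

Lemma card_kfold_uniform1 k (S : {set T}) : S \in kfold (uniform1 T) k -> (#|S| <= k)%N.
Proof.
elim: k S => [|k IH] S; first by rewrite inE => /eqP->; rewrite cards0.
rewrite inE => /existsP[S1 /existsP[S2 /and4P[]]]; rewrite inE => S1le /IH S2le /eqP <- _.
by rewrite (leq_trans (leq_card_setU _ _))// -add1n leq_add.
Qed.

Lemma set0_kfold_uniform1 k : set0 \in kfold (uniform1 T) k.
Proof.
elim: k => [|k IH]; first by rewrite inE.
rewrite inE; apply/existsP; exists set0; apply/existsP; exists set0.
by rewrite inE cards0 IH setU0 eqxx disjoints_subset sub0set.
Qed.

Lemma mem_union2_kfold (M : {set {set T}}) k S : S \in M -> S \in union2 M (kfold (uniform1 T) k).
Proof.
move=> SM; rewrite inE; apply/existsP; exists S; apply/existsP; exists set0.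
by rewrite SM set0_kfold_uniform1 setU0 eqxx disjoint_sym disjoints_subset sub0set.
Qed.

End KFold.

Lemma card_union2_partition n m (blk : 'I_n -> 'I_m) k (S : {set 'I_n}) :
  S \in union2 (partition_matroid blk) (kfold (uniform1 'I_n) k) ->
  (#|S| <= #|blk @: S| + k)%N.
Proof.
rewrite inE => /existsP[S1 /existsP[S2 /and4P[]]]; rewrite inE => /eqP cS1 /card_kfold_uniform1 S2k.
move=> /eqP <- _; rewrite (leq_trans (leq_card_setU _ _))// leq_add// -cS1.
by apply/subset_leq_card/imsetS/subsetUl.
Qed.

(** * Averaging over instances with independent blocks *)

Section HardInstance.
Variables (R : realType) (n m N t B : nat) (blk : 'I_n -> 'I_m) (c : 'I_m -> R).
Hypotheses (t_gt0 : (0 < t)%N) (tN : (t <= N)%N) (B_gt1 : (1 < B)%N).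
Hypotheses (c_ge1 : forall i, 1 <= c i) (c_lt2 : forall i, c i < 2).
Hypothesis c_inj : injective c.

Definition block i := enum [pred e | blk e == i].

Hypothesis size_block : forall i, size (block i) = t.

Implicit Types (x y : {ffun 'I_n -> 'I_N}).

Let B0 : 0 < B%:R :> R. Proof. by rewrite ltr0n ltnW. Qed.
Let B1 : 1 <= B%:R :> R. Proof. by rewrite ler1n ltnW. Qed.
Let c0 i : 0 <= c i. Proof. by rewrite (le_trans ler01). Qed.

Definition instance_mass x : R := \prod_i scaled_prior R t B (map x (block i)).

Definition block_max x i : R := c i * B%:R ^+ seqmax (map x (block i)).

Lemma scaled_prior_ge0 (zs : seq 'I_N) : 0 <= scaled_prior R t B zs :> R.
Proof. by rewrite mulr_ge0 ?prior_ge0// invr_ge0 exprn_ge0// ltW. Qed.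

Lemma instance_mass_ge0 x : 0 <= instance_mass x.
Proof. by apply: prodr_ge0 => i _; apply: scaled_prior_ge0. Qed.

Lemma block_max_ge1 x i : 1 <= block_max x i.
Proof. by rewrite mulr_ege1// exprn_ege1// ler1n ltnW. Qed.

Lemma weight_bounds x e : 0 <= weight blk B c x e <= 2 * B%:R ^+ N.
Proof.
rewrite mulr_ge0 ?exprn_ge0 ?(ltW B0)//= ler_pM ?exprn_ge0 ?(ltW B0) ?(ltW (c_lt2 _))//.
by rewrite (ler_weXn2l B1).
Qed.

(** Since [1 <= c i < 2 <= B], a weight determines the exponent and then the block; inside a block,
    nonzero mass forces distinct values. *)
Lemma weight_inj x : instance_mass x != 0 -> injective (weight blk B c x).
Proof.
move=> mx e e'; rewrite /weight => eq_w.
have lt i j a b : (a < b)%N -> c i * B%:R ^+ a < c j * B%:R ^+ b.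
  move=> ab; apply: (@lt_le_trans _ _ (2 * B%:R ^+ a)); first by rewrite ltr_pM2r ?exprn_gt0.
  apply: (@le_trans _ _ (B%:R ^+ b)); last by rewrite ler_peMl ?exprn_ge0 ?(ltW B0).
  apply: (@le_trans _ _ (B%:R ^+ a.+1)); last exact: ler_weXn2l.
  by rewrite exprS ler_wpM2r ?exprn_ge0 ?(ltW B0)// (ler_nat _ 2).
have xx : x e = x e'.
  case: (ltngtP (x e) (x e')) => [xl|xl|/val_inj//].
    by have := lt (blk e) (blk e') (x e).+1 (x e').+1 xl; rewrite eq_w ltxx.
  by have := lt (blk e') (blk e) (x e').+1 (x e).+1 xl; rewrite eq_w ltxx.
have bb : blk e = blk e'.
  apply: c_inj; move: eq_w; rewrite xx => /mulIf; apply.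
  by rewrite expf_neq0 ?gt_eqF.
have /dinjectiveP inj : uniq (map x (block (blk e))).
  move: mx; rewrite /instance_mass (bigD1 (blk e))//= mulf_eq0 negb_or => /andP[+ _].
  by apply: contraR => /prior_not_uniq H; rewrite /scaled_prior H mul0r.
by apply: inj => //; rewrite inE// bb.
Qed.

Lemma opt_ge_block_max (F : {set {set 'I_n}}) x :
  (forall S, S \in partition_matroid blk -> S \in F) ->
  \sum_i block_max x i <= opt F (weight blk B c x).
Proof.
move=> MF.
have ex i : exists e, (blk e == i) && ((x e).+1 == seqmax (map x (block i)))%N.
  have : (0 < size (map x (block i)))%N by rewrite size_map size_block.
  have seqmax_attained (s : seq 'I_N) : (0 < size s)%N -> exists2 v : 'I_N, v \in s & v.+1 = seqmax s.
    elim: s => // v [|u s] IH _; first by exists v; rewrite ?mem_head// seqmax_cons /seqmax big_nil maxn0.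
    have [//|z zs zE] := IH; rewrite seqmax_cons; case: leqP => _.
      by exists z => //; rewrite inE zs orbT.
    by exists v; rewrite ?mem_head.
  move=> /seqmax_attained[_ /mapP[e + ->] <-]; rewrite mem_enum inE => be.
  by exists e; rewrite be eqxx.
pose pk i := xchoose (ex i).
have pkP i : blk (pk i) = i /\ (x (pk i)).+1 = seqmax (map x (block i)).
  by have /andP[/eqP ? /eqP ?] := xchooseP (ex i).
have pk_inj : injective pk by apply: (can_inj (g := blk)) => i; case: (pkP i).
have -> : \sum_i block_max x i = wsum (weight blk B c x) [set pk i | i : 'I_m].
  rewrite /wsum big_imset /=; last by move=> i j _ _; apply: pk_inj.
  by apply: eq_bigr => i _; rewrite /block_max /weight; case: (pkP i) => -> ->.
apply: (le_bigmax_cond 0 (wsum (weight blk B c x))); apply: MF; rewrite inE.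
apply/imset_injP => _ _ /imsetP[i _ ->] /imsetP[j _ ->].
by case: (pkP i) => -> _; case: (pkP j) => -> _ ->.
Qed.

Lemma exists_instance_mass_gt0 : exists x, 0 < instance_mass x.
Proof.
(* Each element takes its index in its block as value. *)
have idx e : (index e (block (blk e)) < N)%N.
  by rewrite (leq_trans _ tN)// -(size_block (blk e)) index_mem mem_enum inE.
exists [ffun e => Ordinal (idx e)]; apply: prodr_gt0 => i _.
set zs := map _ _.
have uz : uniq zs.
  apply/dinjectiveP => e e'; rewrite !inE => /eqP be /eqP be'.
  rewrite !ffunE => /(congr1 val) /=; rewrite be be' => ee'.
  have inb e1 : blk e1 = i -> e1 \in block i by move=> <-; rewrite mem_enum inE.
  exact: (index_inj e (inb _ be) (inb _ be') ee').
rewrite mulr_gt0 ?invr_gt0 ?exprn_gt0// /prior uz invr_gt0 mulr_gt0 ?ltr0n// ffact_gt0.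
by rewrite -(size_block i) -(size_map [ffun e => Ordinal (idx e)]) uniq_size_seqmax.
Qed.

Variables (F : {set {set 'I_n}}) (A : algorithm R n) (k : nat) (beta : R).
Hypothesis validA : valid_algorithm A.
Hypothesis F0 : set0 \in F.
Hypothesis Fk : forall S, S \in F -> (#|S| <= #|blk @: S| + k)%N.

Let Z := sum_ext t (@prior R N t) [::].

Hypothesis beta_ge : stopping_value R t 0 * harmonic_sum R N + B%:R^-1 * Z <= beta * Z.

(** The factor [B ^ -seqmax] cancels the growth of the block maximum, whose sum over block [i] is
    [c i * Z]; the other blocks enter both sides through the same factor [K]. What remains is
    [beta_ge]. *)
Lemma first_reward_le_block_max i (s : seq 'I_n) : uniq s -> s =i predT ->
  \sum_x instance_mass x * first_reward blk F A (weight blk B c x) i [::] set0 s <=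
  beta * \sum_x instance_mass x * block_max x i.
Proof.
move=> us sT; pose l := [seq e <- s | blk e == i].
have pl : perm_eq (block i) (catrev l [::]).
  rewrite catrevE cats0; apply: uniq_perm; rewrite ?enum_uniq ?rev_uniq ?filter_uniq//.
  by move=> e; rewrite mem_enum mem_rev mem_filter sT andbT.
have ul : uniq (catrev l [::]) by rewrite -(perm_uniq pl) enum_uniq.
have sl : size l = t by rewrite -(size_block i) (perm_size pl) catrevE cats0 size_rev.
have spE y : scaled_prior R t B (map y (block i)) = scaled_prior R t B (map y (catrev l [::])).
  have pz := perm_map y pl; rewrite /scaled_prior (prior_perm _ _ pz).
  by rewrite /seqmax (perm_big _ pz).
have bmE y : block_max y i = c i * B%:R ^+ seqmax (map y (catrev l [::])).
  by rewrite /block_max /seqmax (perm_big _ (perm_map y pl)).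
pose K x : R := \prod_(j | j != i) scaled_prior R t B (map x (block j)).
have K0 x : 0 <= K x by apply: prodr_ge0 => j _; exact: scaled_prior_ge0.
have massE x : instance_mass x = K x * scaled_prior R t B (map x (catrev l [::])).
  by rewrite /instance_mass (bigD1 i)//= spE mulrC.
have Kl y e v : e \in l -> K (upd y e v) = K y.
  rewrite mem_filter => /andP[/eqP be _]; apply: eq_bigr => j ji; rewrite map_upd//.
  by rewrite mem_enum inE be eq_sym.
have N0 : 0 < (N ^ size l)%:R :> R by rewrite ltr0n expn_gt0 (leq_trans t_gt0 tN).
have outer G x : sum_upd l (fun y => instance_mass y * G y) x =
    K x * sum_upd l (fun y => scaled_prior R t B (map y (catrev l [::])) * G y) x.
  transitivity (sum_upd l (fun y => K y * (scaled_prior R t B (map y (catrev l [::])) * G y)) x).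
    by apply: eq_sum_upd => y _; rewrite massE -mulrA.
  exact: sum_upd_mul.
rewrite -(ler_pM2l N0) mulrCA -!(sum_sum_upd l) mulr_sumr; apply: ler_sum => x _.
rewrite !outer mulrCA ler_wpM2l//.
have lt : (size l + size (Nil 'I_n) = t)%N by rewrite sl addn0.
have := @first_reward_bound R n m blk F A validA N t B c (ltnW B_gt1) c0 i s [::] set0 [::] x ul lt.
rewrite -/l sl [potential _ _]/= -/Z => /le_trans; apply.
have -> : sum_upd l (fun y => scaled_prior R t B (map y (catrev l [::])) * block_max y i) x = c i * Z.
  rewrite /Z -{2}sl -[X in sum_ext _ _ X]/(map x [::]) -(sum_upd_ext (prior R t))//.
  rewrite -[RHS]addr0 -(mul0r (sum_upd l (fun=> 0) x)) -sum_upd_lin.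
  apply: eq_sum_upd => y _; rewrite mul0r addr0 bmE mulrCA /scaled_prior -mulrA.
  by rewrite mulVf ?mulr1// expf_neq0 ?gt_eqF.
by rewrite mulrCA ler_wpM2l.
Qed.

Lemma run_le_block_max (s : seq 'I_n) : uniq s -> s =i predT ->
  \sum_x instance_mass x * run F A (weight blk B c x) [::] set0 s <=
  \sum_x instance_mass x * (beta * (\sum_i block_max x i) + 2 * B%:R ^+ N * k%:R).
Proof.
move=> us sT.
apply: (@le_trans _ _ (\sum_x instance_mass x *
   (\sum_i first_reward blk F A (weight blk B c x) i [::] set0 s + 2 * B%:R ^+ N * k%:R))).
  apply: ler_sum => x _; rewrite ler_wpM2l ?instance_mass_ge0//.
  have W0 : 0 <= 2 * B%:R ^+ N :> R by rewrite mulr_ge0 ?exprn_ge0 ?(ltW B0).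
  have notin0 : {in s, forall e, e \notin (set0 : {set 'I_n})} by move=> e _; rewrite inE.
  apply: le_trans
    (@run_le_first_rewards R n m blk F A validA k _ _ W0 Fk (weight_bounds x) s [::] set0 us notin0 F0) _.
  rewrite imset0 !cards0 /wsum big_set0 add0r addr0 subr0 lerD2r.
  by rewrite (eq_bigl predT)// => i; rewrite inE.
under eq_bigr do rewrite mulrDr mulr_sumr.
under [leRHS]eq_bigr do rewrite mulrDr mulrCA mulr_sumr.
rewrite !big_split lerD2r -mulr_sumr /= exchange_big [in leRHS]exchange_big mulr_sumr /=.
by apply: ler_sum => i _; exact: first_reward_le_block_max.
Qed.

(** Competitiveness on every instance would carry over to the average. The extra acceptances are
    worth less than [gap * m], while the [m] block maxima are at least 1 each. *)
Lemma not_competitive (alpha gap : R) :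
  (forall S, S \in partition_matroid blk -> S \in F) ->
  beta + gap <= alpha -> 0 <= alpha -> 0 <= gap -> 2 * B%:R ^+ N * k%:R < gap * m%:R ->
  ~ competitive F A alpha.
Proof.
move=> MF ba alpha0 gap0 hm comp.
pose Q := #|{perm 'I_n}|%:R : R.
have Q0 : 0 < Q by rewrite ltr0n; apply/card_gt0P; exists 1%g.
pose W : R := 2 * B%:R ^+ N * k%:R; rewrite -/W in hm.
(* Distinct weights are guaranteed for instances of nonzero mass; for the others both sides
   vanish. *)
have lower x : alpha * (instance_mass x * \sum_i block_max x i) <=
    instance_mass x * expected_alg F A (weight blk B c x).
  have [->|mx] := eqVneq (instance_mass x) 0; first by rewrite !mul0r mulr0.
  rewrite mulrCA ler_wpM2l ?instance_mass_ge0//.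
  apply: le_trans (comp _ (weight_inj mx) _); last by move=> e; have /andP[] := weight_bounds x e.
  by rewrite ler_wpM2l// opt_ge_block_max.
have upper : \sum_x instance_mass x * expected_alg F A (weight blk B c x) <=
    \sum_x instance_mass x * (beta * (\sum_i block_max x i) + W).
  rewrite /expected_alg -/Q.
  under eq_bigr do rewrite mulrA mulr_sumr.
  rewrite -mulr_suml exchange_big /= ler_pdivrMr//.
  have -> : forall a : R, a * Q = \sum_(p : {perm 'I_n}) a.
    by move=> a; rewrite sumr_const mulr_natr; congr (_ *+ _); apply: eq_card.
  apply: ler_sum => p _; apply: run_le_block_max.
    by rewrite map_inj_uniq ?enum_uniq//; exact: perm_inj.
  by move=> e; apply/mapP; exists (p^-1%g e); rewrite ?mem_enum ?permKV.
have : \sum_x alpha * (instance_mass x * \sum_i block_max x i) <=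
    \sum_x instance_mass x * (beta * (\sum_i block_max x i) + W).
  by apply: le_trans upper; apply: ler_sum => x _; exact: lower.
have term x : 0 <= alpha * (instance_mass x * \sum_i block_max x i) -
    instance_mass x * (beta * (\sum_i block_max x i) + W) - instance_mass x * (gap * m%:R - W).
  have -> : alpha * (instance_mass x * \sum_i block_max x i) -
    instance_mass x * (beta * (\sum_i block_max x i) + W) - instance_mass x * (gap * m%:R - W)
    = instance_mass x * ((alpha - beta) * (\sum_i block_max x i) - gap * m%:R) by ring.
  have bm : m%:R <= \sum_i block_max x i.
    have -> : m%:R = \sum_(i < m) 1 :> R by rewrite sumr_const card_ord.
    by apply: ler_sum => i _; exact: block_max_ge1.
  rewrite mulr_ge0 ?instance_mass_ge0// subr_ge0.
  by apply: ler_pM => //; lra.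
have [x0 mx0] := exists_instance_mass_gt0.
apply/negP; rewrite -ltNge -subr_gt0 -sumrB.
apply: (@lt_le_trans _ _ (\sum_x instance_mass x * (gap * m%:R - W))).
  rewrite -mulr_suml mulr_gt0 ?subr_gt0//.
  rewrite (bigD1 x0)//= ltr_pwDl// sumr_ge0// => x _; exact: instance_mass_ge0.
by apply: ler_sum => x _; rewrite -subr_ge0.
Qed.

End HardInstance.

(** * Choice of the parameters *)

Lemma ln_le_harmonic_sum (R : realType) N : ln (N.+1%:R : R) <= harmonic_sum R N.
Proof.
rewrite /harmonic_sum; elim: N => [|N IH]; first by rewrite big_geq// ln1.
rewrite big_nat_recr//=.
have -> : N.+2%:R = N.+1%:R * (1 + N.+1%:R^-1) :> R by rewrite -natr1; field; rewrite nat1r pnatr_eq0.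
rewrite lnM ?posrE ?addr_gt0 ?invr_gt0 ?ltr0n//; apply: lerD => //.
by apply: le_ln1Dx; apply: (@lt_trans _ _ 0); rewrite ?invr_gt0 ?ltr0n// oppr_lt0.
Qed.

Theorem theorem2 (R : realType) (eps : R) (k : nat) :
  0 < eps ->
  exists (n : nat) (M : {set {set 'I_n}}),
    [/\ is_matroid M, loopless M &
        forall A : algorithm R n, valid_algorithm A ->
          ~ competitive (union2 M (kfold (uniform1 'I_n) k)) A
              ((expR 1)^-1 + eps)].
Proof.
move=> eps0; have e0 := inv_expR1_gt0 R; set e1 : R := (expR 1)^-1 in e0 *.
have q0 : 0 <= 4 / eps by rewrite divr_ge0 ?(ltW eps0).
pose t := Num.bound (4 / eps); have tq : 4 / eps < t%:R := archi_boundP q0.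
have t0 : (0 < t)%N by rewrite -(ltr0n R) (le_lt_trans q0).
have inv_le (b : R) : 4 / eps < b -> b^-1 <= eps / 4.
  move=> qb; have b0 := le_lt_trans q0 qb.
  by rewrite -[leRHS]invf_div lef_pV2 ?posrE ?divr_gt0// ltW.
have ti := inv_le _ tq.
(* Makes [eps / 4 * L] equal to [e1 + eps / 2] times the loss [t + 1] in [sum_ext_prior0_ge]; [N] is
   then taken so large that the harmonic sum reaches [L]. *)
pose L : R := 4 * (t%:R + 1) * (e1 + eps / 2) / eps.
pose N := (t + Num.bound (expR L))%N.
have HL : L <= harmonic_sum R N.
  apply: le_trans (ln_le_harmonic_sum _ _); rewrite -[leLHS]expRK.
  rewrite ler_ln ?posrE ?expR_gt0 ?ltr0n//.
  apply: le_trans (ltW (archi_boundP (expR_ge0 L))) _.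
  by rewrite ler_nat leqW// leq_addl.
have tN : (t <= N)%N by rewrite leq_addr.
pose B := (Num.bound (4 / eps)).+2.
have Bi : B%:R^-1 <= eps / 4.
  by apply: inv_le; apply: lt_le_trans (archi_boundP q0) _; rewrite ler_nat leqW.
pose W : R := 2 * B%:R ^+ N * k%:R.
have W0 : 0 <= W by rewrite !mulr_ge0 ?exprn_ge0.
pose m := (Num.bound (W * (4 / eps))).+1.
have Wm : W < eps / 4 * m%:R.
  have : W * (4 / eps) < m%:R.
    by apply: lt_le_trans (archi_boundP (mulr_ge0 W0 q0)) _; rewrite ler_nat.
  by rewrite -ltr_pdivlMr ?divr_gt0// invf_div mulrC.
pose n := #|{: 'I_m * 'I_t}|.
pose blk (e : 'I_n) : 'I_m := (enum_val e).1.
have size_block i : size (block blk i) = t.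
  have inj : injective (fun j : 'I_t => enum_rank (i, j)).
    by move=> j j' /enum_rank_inj[].
  rewrite -cardE -[RHS]card_ord -(card_codom inj); apply: eq_card => e; rewrite inE.
  apply/eqP/codomP => [be|[j ->]]; last by rewrite /blk enum_rankK.
  by exists (enum_val e).2; rewrite -be -surjective_pairing enum_valK.
pose c (i : 'I_m) : R := 1 + i%:R / m%:R.
have m0 : 0 < m%:R :> R by rewrite ltr0n.
have c1 i : 1 <= c i by rewrite lerDl divr_ge0.
have c2 i : c i < 2.
  by rewrite /c -[ltRHS]natr1 addrC ltrD2r ltr_pdivrMr// mul1r ltr_nat.
have c_inj : injective c.
  by move=> i j /addrI /(mulIf (invr_neq0 (lt0r_neq0 m0))) /eqP; rewrite eqr_nat => /eqP /val_inj.
have MF S : S \in partition_matroid blk ->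
  S \in union2 (partition_matroid blk) (kfold (uniform1 'I_n) k).
  exact: mem_union2_kfold.
exists n, (partition_matroid blk); split.
- exact: partition_matroidP.
- exact: partition_matroid_loopless.
move=> A validA.
(* One quarter of [eps] each goes to [1 / t], to [1 / B], to the truncation at [N], and, as [gap],
   to the [k] extra elements. *)
apply: (@not_competitive R n m N t B blk c t0 tN _ c1 c2 c_inj size_block _ A k
  (e1 + 3 / 4 * eps) validA _ (@card_union2_partition _ _ _ _) _ _ (eps / 4)) => //; try lra.
- by apply: MF; rewrite inE imset0 !cards0.
- rewrite stopping_value0 -/e1.
  set Z := sum_ext _ _ _.
  have ZH : harmonic_sum R N - (t%:R + 1) <= Z by apply: sum_ext_prior0_ge; rewrite t0.
  have LE : eps / 4 * L = (t%:R + 1) * (e1 + eps / 2).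
    by rewrite /L; field; rewrite gt_eqF.
  have Z0 : 0 <= Z by apply: sum_ext_ge0; exact: prior_ge0.
  have H0 : 0 <= harmonic_sum R N by apply: sumr_ge0.
  have a1 : (e1 + t%:R^-1) * harmonic_sum R N <= (e1 + eps / 4) * harmonic_sum R N.
    by rewrite ler_wpM2r// lerD2l.
  have a2 : B%:R^-1 * Z <= eps / 4 * Z by rewrite ler_wpM2r.
  have a3 : eps / 4 * L <= eps / 4 * harmonic_sum R N by rewrite ler_wpM2l//; lra.
  have a4 : (e1 + eps / 2) * (harmonic_sum R N - (t%:R + 1)) <= (e1 + eps / 2) * Z.
    by rewrite ler_wpM2l//; lra.
  nra.
Qed.
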